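(* Let $A,B$ be complex $3\times 3$ matrices. The following are equivalent: (1) $A$ and $B$ have identical pseudospectra (i.e. $\|(zI-A)^{-1}\|=\|(zI-B)^{-1}\|$ for all $z\in\mathbb{C}$) and $\chi_A=\chi_B$; (2) $A$ and $B$ have super-identical pseudospectra, i.e. $s_k(zI-A)=s_k(zI-B)$ for all $z\in\mathbb{C}$ and $k=1,2,3$.
   Context: $\|\cdot\|$ is the spectral norm; by convention $\|(zI-T)^{-1}\|=\infty$ for $z$ an eigenvalue of $T$. $\chi_T(z)=\det(zI-T)$ is the characteristic polynomial. $s_1(T)\ge s_2(T)\ge s_3(T)$ are the singular values of $T$. *)

(* Defs.v *)
From HB Require Import structures.
From mathcomp Require Import all_boot all_order all_algebra.
From mathcomp Require Import complex.
From mathcomp Require Import boolp classical_sets reals constructive_ereal.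

Set Implicit Arguments.
Unset Strict Implicit.
Unset Printing Implicit Defensive.
Import Order.TTheory GRing.Theory Num.Theory.
Local Open Scope ring_scope.

Section Defs.
Variable R : realType.
Local Notation C := R[i].

Definition adjmx m n (M : 'M[C]_(m, n)) : 'M[C]_(n, m) :=
  (map_mx (@conjc R) M)^T.

Definition vnorm n (x : 'cV[C]_n) : R :=
  Num.sqrt (\sum_i (ComplexField.Normc.normc (x i 0)) ^+ 2).

Definition specnorm n (M : 'M[C]_n) : R :=
  sup [set vnorm (M *m x) | x in [set x : 'cV[C]_n | vnorm x = 1]]%classic.

Definition resolvent_norm n (T : 'M[C]_n) (z : C) : \bar R :=
  if (z%:M - T) \in unitmx then (specnorm (invmx (z%:M - T)))%:E
  else +oo%E.

(* s is the nonincreasing list s_1 >= ... >= s_n >= 0 of the singular values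
   of M, i.e. the s_k^2 are the eigenvalues (with multiplicity) of M^* M *)
Definition is_svals n (M : 'M[C]_n) (s : 'I_n -> R) : Prop :=
  (forall k, 0 <= s k) /\
  (forall k l : 'I_n, (k <= l)%N -> s l <= s k) /\
  char_poly (adjmx M *m M) = \prod_(k < n) ('X - ((s k) ^+ 2)%:C%C%:P).

(* the singular values s_1(M) >= ... >= s_n(M) (index k : 'I_n is s_{k+1}) *)
Definition svals n (M : 'M[C]_n) : 'I_n -> R :=
  xget (fun _ => 0) (is_svals M).

End Defs.

(* Main.v *)
(** The resolvent norm at z is 1 / s_3(zI - A), and the singular values of M are
    determined by the characteristic polynomial of M^* M, i.e. by its trace, its
    second elementary symmetric function e_2 and its determinant.

    If the singular values of zI - A and zI - B agree, then so do s_3 and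
    |chi_A(z)|, |chi_B(z)| for all z, and polarization gives chi_A = chi_B.

    Conversely, off the spectrum t(z) = s_3(zI - A)^2 = s_3(zI - B)^2 is a common
    root of both cubics, which have the same constant term |chi(z)|^2; hence
    c t(z) = d(z), where c = |A|_F^2 - |B|_F^2 is the difference of the traces and
    the difference d(z) of the e_2's is c |z|^2 plus a real-affine function of z.
    If c <> 0, then t(z) = |z - w|^2 + g, and 0 < t(z) <= |z - l|^2 for every
    eigenvalue l forces w = l and g = 0. So w is the only eigenvalue, and
    s_1^2 s_2^2 s_3^2 = |z - w|^6 = s_3^6 makes all singular values equal for both
    matrices, contradicting c <> 0. If c = 0, then d vanishes off the spectrum,
    hence identically. *)

Require Import Defs.
From HB Require Import structures.
From mathcomp Require Import all_boot all_order all_algebra.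
From mathcomp Require Import complex ring.
From mathcomp Require Import boolp classical_sets reals constructive_ereal.
Set Implicit Arguments.
Unset Strict Implicit.
Unset Printing Implicit Defensive.
Import Order.TTheory GRing.Theory Num.Theory.
Local Open Scope ring_scope.

(** * Gram matrices, their unitary diagonalization and the existence of singular values *)

Section Gram.
Variable R : realType.
Local Notation C := R[i].

Lemma adjmxE m n (M : 'M[C]_(m, n)) : adjmx M = (M ^t Num.conj)%sesqui.
Proof. by rewrite /adjmx map_trmx. Qed.

Lemma adjmxK m n (M : 'M[C]_(m, n)) : adjmx (adjmx M) = M.
Proof. by apply/matrixP => i j; rewrite !mxE conjcK. Qed.

Lemma adjmxM m n p (M : 'M[C]_(m, n)) (N : 'M[C]_(n, p)) :
  adjmx (M *m N) = adjmx N *m adjmx M.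
Proof. by rewrite /adjmx map_mxM trmx_mul. Qed.

Lemma adjmxB m n (M N : 'M[C]_(m, n)) : adjmx (M - N) = adjmx M - adjmx N.
Proof. by rewrite /adjmx map_mxB linearB. Qed.

Lemma adjmx_scalar n (z : C) : adjmx (z%:M : 'M_n) = (z^*)%:M.
Proof. by rewrite /adjmx map_scalar_mx tr_scalar_mx. Qed.

Lemma mxtrace_adjmx n (M : 'M[C]_n) : \tr (adjmx M) = (\tr M)^*.
Proof. by rewrite /adjmx mxtrace_tr -(trace_map_mx Num.conj). Qed.

Lemma det_adjmx n (M : 'M[C]_n) : \det (adjmx M) = (\det M)^*.
Proof. by rewrite /adjmx det_tr -(det_map_mx Num.conj). Qed.

Lemma adjmx_mulE m n (M : 'M[C]_(m, n)) j :
  (adjmx M *m M) j j = \sum_i `|M i j| ^+ 2.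
Proof. by rewrite mxE; apply: eq_bigr => i _; rewrite !mxE normCK mulrC. Qed.

Lemma vnorm_ge0 n (x : 'cV[C]_n) : 0 <= vnorm x.
Proof. exact: sqrtr_ge0. Qed.

Lemma vnorm_sq n (x : 'cV[C]_n) :
  (vnorm x ^+ 2)%:C%C = (adjmx x *m x) 0 0 :> C.
Proof.
rewrite adjmx_mulE sqr_sqrtr; last by apply: sumr_ge0 => i _; exact: sqr_ge0.
by rewrite rmorph_sum; apply: eq_bigr => i _; rewrite rmorphXn.
Qed.

Lemma vnorm_sqE n (x : 'cV[C]_n) :
  vnorm x ^+ 2 = \sum_i (ComplexField.Normc.normc (x i 0)) ^+ 2.
Proof. by rewrite sqr_sqrtr //; apply: sumr_ge0 => i _; exact: sqr_ge0. Qed.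

Lemma vnormZ n (a : C) (x : 'cV[C]_n) :
  vnorm (a *: x) = ComplexField.Normc.normc a * vnorm x.
Proof.
have a0 : 0 <= ComplexField.Normc.normc a by case: a => ? ?; exact: sqrtr_ge0.
apply/eqP; rewrite -(@eqrXn2 _ 2) ?mulr_ge0 ?vnorm_ge0 //.
rewrite exprMn !vnorm_sqE mulr_sumr; apply/eqP/eq_bigr => i _.
by rewrite mxE ComplexField.Normc.normcM exprMn.
Qed.

Lemma vnormZr n (a : R) (x : 'cV[C]_n) :
  0 <= a -> vnorm (a%:C%C *: x) = a * vnorm x.
Proof.
by move=> a0; rewrite vnormZ /= expr0n /= addr0 sqrtr_sqr ger0_norm.
Qed.

Lemma gram_spectral n (M : 'M[C]_n) : exists (P : 'M[C]_n) (d : 'I_n -> R),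
  [/\ P *m adjmx P = 1%:M, adjmx P *m P = 1%:M, forall k, 0 <= d k &
      adjmx M *m M = adjmx P *m diag_mx (\row_k (d k)%:C%C) *m P].
Proof.
set N := adjmx M *m M.
have hN : N \is hermsymmx.
  apply/is_hermitianmxP; rewrite expr0 scale1r -adjmxE.
  by rewrite /N adjmxM adjmxK.
have /orthomx_spectralP := hermitian_normalmx hN.
set P := spectralmx N; set D := spectral_diag N.
have uP : P \is unitarymx by exact: spectral_unitarymx.
rewrite invmx_unitary // -adjmxE => eN.
have P1 : P *m adjmx P = 1%:M by rewrite adjmxE; apply/unitarymxP.
have P2 : adjmx P *m P = 1%:M by exact: mulmx1C.
(* [D 0 k] is a diagonal entry of the Gram matrix of [M *m adjmx P], hence a sum of squared
   moduli. *)
have D0 k : 0 <= D 0 k.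
  have -> : D 0 k = (P *m N *m adjmx P) k k.
    by rewrite eN !mulmxA P1 mul1mx -mulmxA P1 mulmx1 mxE eqxx mulr1n.
  have -> : P *m N *m adjmx P = adjmx (M *m adjmx P) *m (M *m adjmx P).
    by rewrite adjmxM adjmxK !mulmxA.
  by rewrite adjmx_mulE sumr_ge0 // => i _; rewrite exprn_ge0.
exists P, (fun k => complex.Re (D 0 k)); split; [exact: P1|exact: P2|move=> k|].
  by have := D0 k; rewrite lecE /= => /andP[].
rewrite {1}eN; congr (_ *m diag_mx _ *m _); apply/rowP => k; rewrite mxE.
by rewrite RRe_real // ger0_real.
Qed.

Lemma char_poly_gram n (M P : 'M[C]_n) (d : 'I_n -> R) :
  P *m adjmx P = 1%:M ->
  adjmx M *m M = adjmx P *m diag_mx (\row_k (d k)%:C%C) *m P ->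
  char_poly (adjmx M *m M) = \prod_k ('X - (d k)%:C%C%:P).
Proof.
move=> PP ->; have uP : P \in unitmx by have [] := mulmx1_unit PP.
set D := diag_mx _.
have -> : char_poly (adjmx P *m D *m P) = char_poly D.
  rewrite /char_poly /char_poly_mx !map_mxM.
  have PX : map_mx polyC P *m map_mx polyC (adjmx P) = 1%:M.
    by rewrite -map_mxM PP map_mx1.
  have -> : 'X%:M - map_mx polyC (adjmx P) *m map_mx polyC D *m map_mx polyC P
     = map_mx polyC (adjmx P) *m ('X%:M - map_mx polyC D) *m map_mx polyC P.
    rewrite mulmxBr mulmxBl; congr (_ - _).
    by rewrite scalar_mxC -mulmxA (mulmx1C PX) mulmx1.
  by rewrite !det_mulmx mulrC mulrA -det_mulmx PX det1 mul1r.
rewrite char_poly_trig; last exact/diag_mx_is_trig.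
by apply: eq_bigr => k _; rewrite !mxE eqxx mulr1n.
Qed.

(** Sorting the square roots of the Gram eigenvalues gives a valid list, so [xget] in [svals] never
    falls back on its default value. *)
Lemma is_svals_exists n (M : 'M[C]_n) : exists s, is_svals M s.
Proof.
have [P [d [P1 _ d0 eN]]] := gram_spectral M.
have cN := char_poly_gram P1 eN.
pose q := sort (fun x y : R => y <= x) [seq Num.sqrt (d k) | k <- enum 'I_n].
have sq : size q = n by rewrite size_sort size_map size_enum_ord.
exists (fun k => q`_k); split; [|split].
- move=> k; have : q`_k \in q by rewrite mem_nth ?sq.
  by rewrite mem_sort => /mapP[j _ ->]; exact: sqrtr_ge0.
- move=> k l kl.
  have tr : transitive (fun x y : R => y <= x) by move=> a b c ab bc; exact: le_trans ab.
  apply: (sorted_leq_nth tr) => //; rewrite ?inE ?sq //.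
  by apply: sort_sorted => x y; exact: le_total.
- rewrite cN.
  have -> : \prod_(k < n) ('X - (q`_k ^+ 2)%:C%C%:P) =
            \prod_(a <- q) ('X - (a ^+ 2)%:C%C%:P).
    by rewrite (big_nth 0) sq big_mkord.
  rewrite (perm_big _ (permEl (perm_sort _ _))) /= big_map big_enum /=.
  by apply: eq_bigr => k _; rewrite sqr_sqrtr.
Qed.

Lemma svalsP n (M : 'M[C]_n) : is_svals M (svals M).
Proof. by have [s Ms] := is_svals_exists M; exact: (xgetPex _ (ex_intro _ s Ms)). Qed.

End Gram.

(** * The smallest singular value as least stretch, and the norm of the inverse *)

Section SpectralNorm.
Variable R : realType.
Local Notation C := R[i].

Lemma eq_prod_XsubC_mem (F : idomainType) n (d e : 'I_n -> F) :
  \prod_k ('X - (d k)%:P) = \prod_k ('X - (e k)%:P) ->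
  forall k, exists j, d j = e k.
Proof.
move=> de k; have : root (\prod_k ('X - (e k)%:P)) (e k).
  by rewrite (bigD1 k) //= rootM root_XsubC eqxx.
rewrite -de -(big_map d xpredT (fun a => 'X - a%:P)) root_prod_XsubC.
by case/mapP => j _ ->; exists j.
Qed.

Lemma char_poly_gram_root n (M : 'M[C]_n) (s : 'I_n -> R) (k : 'I_n) :
  is_svals M s -> root (char_poly (adjmx M *m M)) ((s k) ^+ 2)%:C%C.
Proof.
by case=> _ [_ ->]; rewrite (bigD1 k) //= rootM root_XsubC eqxx.
Qed.

Lemma vnorm_unitary n (P : 'M[C]_n) (x : 'cV[C]_n) :
  adjmx P *m P = 1%:M -> vnorm (P *m x) = vnorm x.
Proof.
move=> PP; apply/eqP; rewrite -(@eqrXn2 _ 2) ?vnorm_ge0 //.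
rewrite -(inj_eq (@complexI R)) !vnorm_sq adjmxM -mulmxA (mulmxA (adjmx P)).
by rewrite PP mul1mx.
Qed.

Lemma vnorm_sq_diag n (M P : 'M[C]_n) (d : 'I_n -> R) (x : 'cV[C]_n) :
  adjmx M *m M = adjmx P *m diag_mx (\row_k (d k)%:C%C) *m P ->
  vnorm (M *m x) ^+ 2 =
    \sum_k d k * ComplexField.Normc.normc ((P *m x) k 0) ^+ 2.
Proof.
move=> eN; apply: (@complexI R); rewrite vnorm_sq adjmxM -mulmxA (mulmxA (adjmx M)) eN.
rewrite !mulmxA -adjmxM -mulmxA; move: (P *m x) => y.
rewrite mxE rmorph_sum; apply: eq_bigr => k _.
rewrite mul_mx_diag !mxE [RHS]rmorphM rmorphXn /=.
by rewrite -[X in _ = _ * X ^+ 2]/(`|y k 0|) normCK; ring.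
Qed.

(** In the coordinates [P *m x], |Mx|^2 is a sum of squared moduli weighted by the [d k]; each
    weight is a squared singular value, hence at least the square of the last one. *)
Lemma svals_min_le n (M : 'M[C]_n.+1) (s : 'I_n.+1 -> R) (x : 'cV[C]_n.+1) :
  is_svals M s -> s ord_max * vnorm x <= vnorm (M *m x).
Proof.
move=> [s0 [sn cs]]; have [P [d [P1 P2 d0 eN]]] := gram_spectral M.
rewrite -ler_sqr ?nnegrE ?mulr_ge0 ?vnorm_ge0 //.
rewrite exprMn (vnorm_sq_diag _ eN) -(vnorm_unitary x P2) vnorm_sqE mulr_sumr.
apply: ler_sum => k _; apply: ler_wpM2r; first exact: sqr_ge0.
have := char_poly_gram P1 eN; rewrite cs => /esym e.
have [j /complexI <-] := eq_prod_XsubC_mem (esym e) k.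
by rewrite ler_sqr ?nnegrE // sn // leq_ord.
Qed.

(** The witness is the unit eigenvector [adjmx P *m delta_mx j 0] of the Gram matrix, with j chosen
    so that [d j] is the square of [s k]. *)
Lemma svals_attained n (M : 'M[C]_n) (s : 'I_n -> R) k :
  is_svals M s -> exists2 x : 'cV[C]_n, vnorm x = 1 & vnorm (M *m x) = s k.
Proof.
move=> [s0 [sn cs]]; have [P [d [P1 P2 d0 eN]]] := gram_spectral M.
have := char_poly_gram P1 eN; rewrite cs => /esym e.
have [j /complexI dj] := eq_prod_XsubC_mem e k.
have nd i : ComplexField.Normc.normc ((delta_mx j 0 : 'cV[C]_n) i 0) ^+ 2 = (i == j)%:R.
  rewrite mxE andbT; case: (i == j) => /=; rewrite /= ?expr0n ?expr1n /= ?addr0.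
    by rewrite sqrtr1 expr1n.
  by rewrite sqrtr0 expr0n.
exists (adjmx P *m delta_mx j 0).
- rewrite vnorm_unitary ?adjmxK // /vnorm.
  under eq_bigr do rewrite nd.
  by rewrite (bigD1 j) //= eqxx big1 ?addr0 ?sqrtr1 // => i /negbTE ->.
- apply/eqP; rewrite -(@eqrXn2 _ 2) ?vnorm_ge0 // (vnorm_sq_diag _ eN).
  rewrite !mulmxA P1 mul1mx -dj.
  under eq_bigr do rewrite nd.
  by rewrite (bigD1 j) //= eqxx mulr1 big1 ?addr0 // => i /negbTE ->; rewrite mulr0.
Qed.

Lemma svals_unitmx_gt0 n (M : 'M[C]_n) (s : 'I_n -> R) k :
  is_svals M s -> M \in unitmx -> 0 < s k.
Proof.
move=> Ms uM; case: (Ms) => s0 _; rewrite lt_neqAle s0 andbT eq_sym.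
apply/eqP => sk; have := char_poly_gram_root k Ms; rewrite sk expr0n /=.
rewrite -eigenvalue_root_char => /eigenvalueP[v /eqP]; rewrite scale0r.
have uN : adjmx M *m M \in unitmx.
  by rewrite unitmx_mul uM andbT unitmxE det_adjmx unitfE conjC_eq0 -unitfE -unitmxE.
by rewrite mulmx_free_eq0 ?row_free_unit // => ->.
Qed.

(** The least stretch of [M] bounds the stretch of its inverse; the normalized image of a
    least-stretched vector attains the bound. *)
Lemma specnorm_invmx n (M : 'M[C]_n.+1) (s : 'I_n.+1 -> R) :
  is_svals M s -> M \in unitmx -> specnorm (invmx M) = (s ord_max)^-1.
Proof.
move=> Ms uM; have sgt := svals_unitmx_gt0 ord_max Ms uM.
rewrite /specnorm; set E := (X in sup X).
have ub : ubound (T:=R) E (s ord_max)^-1.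
  move=> _ [x /= x1 <-]; rewrite -[leRHS]mulr1 ler_pdivlMl //.
  by rewrite -x1 -{2}(mulKVmx uM x); exact: svals_min_le.
have Es : E (s ord_max)^-1.
  have [x x1 Mx] := svals_attained ord_max Ms.
  exists ((s ord_max)^-1%:C%C *: (M *m x)) => /=.
    by rewrite vnormZr ?invr_ge0 ?ltW // Mx mulVf ?gt_eqF.
  by rewrite -scalemxAr mulKmx // vnormZr ?invr_ge0 ?ltW // x1 mulr1.
apply/eqP; rewrite eq_le; apply/andP; split.
  by apply: ge_sup => //; exists (s ord_max)^-1.
by apply: ub_le_sup => //; exists (s ord_max)^-1.
Qed.

End SpectralNorm.

(** * The characteristic polynomial of a 3x3 matrix from traces and determinant *)

Section CharPoly3.

Local Notation o0 := (@Ordinal 3 0 isT).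
Local Notation o1 := (@Ordinal 3 1 isT).
Local Notation o2 := (@Ordinal 3 2 isT).

Lemma sum3 (F : nmodType) (f : 'I_3 -> F) : \sum_k f k = f o0 + (f o1 + f o2).
Proof.
rewrite !big_ord_recl big_ord0 addr0.
by congr (f _ + (f _ + f _)); apply: val_inj.
Qed.

Lemma det2 (F : comNzRingType) (N : 'M[F]_2) :
  \det N = N 0 0 * N 1 1 - N 0 1 * N 1 0.
Proof.
rewrite (expand_det_row _ 0) !big_ord_recl big_ord0 addr0 /cofactor !det_mx11.
rewrite !mxE /= addn0 expr0 expr1 mul1r mulN1r mulrN.
by congr (_ * N _ _ - N _ _ * N _ _); apply: val_inj.
Qed.

Lemma det3 (F : comNzRingType) (N : 'M[F]_3) :
  \det N = N o0 o0 * (N o1 o1 * N o2 o2 - N o1 o2 * N o2 o1)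
         - N o0 o1 * (N o1 o0 * N o2 o2 - N o1 o2 * N o2 o0)
         + N o0 o2 * (N o1 o0 * N o2 o1 - N o1 o1 * N o2 o0).
Proof.
rewrite (expand_det_row _ o0) sum3 /cofactor !det2 !mxE.
have -> : lift o0 (0 : 'I_2) = o1 by exact: val_inj.
have -> : lift o0 (1 : 'I_2) = o2 by exact: val_inj.
have -> : lift o1 (0 : 'I_2) = o0 by exact: val_inj.
have -> : lift o1 (1 : 'I_2) = o2 by exact: val_inj.
have -> : lift o2 (0 : 'I_2) = o0 by exact: val_inj.
have -> : lift o2 (1 : 'I_2) = o1 by exact: val_inj.
rewrite addn0 expr0 addn1 expr1 add0n sqrrN expr1n; ring.
Qed.

Lemma char_poly3 (F : numFieldType) (N : 'M[F]_3) :
  char_poly N = 'X^3 - (\tr N)%:P * 'X^2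
     + (((\tr N) ^+ 2 - \tr (N *m N)) / 2%:R)%:P * 'X - (\det N)%:P.
Proof.
(* Newton's identity: the coefficient of X is the sum of the principal 2x2 minors. *)
have -> : ((\tr N) ^+ 2 - \tr (N *m N)) / 2%:R =
   N o0 o0 * N o1 o1 - N o0 o1 * N o1 o0 + (N o0 o0 * N o2 o2 - N o0 o2 * N o2 o0)
   + (N o1 o1 * N o2 o2 - N o1 o2 * N o2 o1).
  rewrite /mxtrace !sum3 !mxE !sum3; by field; rewrite ?pnatr_eq0.
rewrite (det3 N) [char_poly N](det3 (char_poly_mx N)) /mxtrace sum3 !mxE /=; ring.
Qed.

End CharPoly3.

(** * Traces of the Gram matrix of zI - A and of its square, as ring identities *)

Section ShiftedProduct.
Variables (F : comNzRingType) (n : nat) (A A' : 'M[F]_n) (z z' : F).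
(** [A'] and [z'] stand for the adjoint of A and the conjugate of z; keeping them independent makes
    the identities purely algebraic. *)
Let N := (z'%:M - A') *m (z%:M - A).

Lemma shifted_productE : N = (z' * z)%:M - z' *: A - z *: A' + A' *m A.
Proof.
rewrite /N mulmxBr !mulmxBl -scalar_mxM mul_mx_scalar mul_scalar_mx opprB.
by rewrite [_ - z' *: A]addrC addrA; congr (_ + _); exact: addrAC.
Qed.

Lemma mxtrace_shifted_product :
  \tr N = n%:R * (z' * z) - z' * \tr A - z * \tr A' + \tr (A' *m A).
Proof.
rewrite shifted_productE !linearD !linearN /= !linearZ /= mxtrace_scalar.
by rewrite mulr_natl.
Qed.

Lemma mxtrace_shifted_product_sq :
  \tr (N *m N) = n%:R * (z' * z) ^+ 2 + z' ^+ 2 * \tr (A *m A)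
    + z ^+ 2 * \tr (A' *m A') + \tr (A' *m A *m (A' *m A))
    - 2%:R * (z' * z) * (z' * \tr A + z * \tr A')
    + 4%:R * (z' * z) * \tr (A' *m A)
    - 2%:R * z' * \tr (A *m (A' *m A)) - 2%:R * z * \tr (A' *m (A' *m A)).
Proof.
have trN (X : 'M[F]_n) : \tr (- X) = - \tr X by exact: raddfN.
rewrite shifted_productE; set G := A' *m A; set s := z' * z.
rewrite !(mulmxDl, mulmxBl) !(mulmxDr, mulmxBr, mulmxN, mulNmx).
rewrite -!scalemxAl -!scalemxAr -!scalar_mxM !(mul_mx_scalar, mul_scalar_mx).
rewrite !(mxtraceD, trN) !mxtraceZ mxtrace_scalar.
rewrite (mxtrace_mulC A A') (mxtrace_mulC G A) (mxtrace_mulC G A') -/G.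
rewrite -[_ *+ n]mulr_natl /s; ring.
Qed.

End ShiftedProduct.

(** * Polynomial identities and real-affine inequalities off a finite set of roots *)

Section OffRoots.

(** A nonzero polynomial has fewer roots than its size. This picks points off the spectrum along any
    sequence of distinct points. *)
Lemma poly_nonroot (F : idomainType) (P : {poly F}) (f : nat -> F) :
  P != 0 -> injective f -> exists n, P.[f n] != 0.
Proof.
move=> P0 fI; apply: contrapT => nex.
pose rs := [seq f n | n <- iota 0 (size P)].
have : (size rs < size P)%N.
  apply: max_poly_roots => //; last by rewrite map_inj_uniq ?iota_uniq.
  apply/allP => _ /mapP[n _ ->]; apply/negPn/negP => Pn; apply: nex.
  by exists n.
by rewrite size_map size_iota ltnn.
Qed.

Lemma poly_eq_nat (F : numDomainType) (p q : {poly F}) :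
  (forall n, p.[n%:R] = q.[n%:R]) -> p = q.
Proof.
move=> pq; apply/eqP; rewrite -subr_eq0; apply/negPn/negP => pq0.
have [n] := poly_nonroot pq0 (@mulrIn _ 1 (oner_neq0 F)).
by rewrite hornerD hornerN pq subrr eqxx.
Qed.

Variable C : numClosedFieldType.
Implicit Types (P p q : {poly C}) (u v w z g l : C).

(** If u were nonzero, moving z far in the direction opposite to the conjugate of u would make the
    expression negative. *)
Lemma affine_ge0_const P u v : P != 0 ->
  (forall z, P.[z] != 0 -> 0 <= z * u + z^* * u^* + v) -> u = 0.
Proof.
move=> P0 h; apply/eqP/negPn/negP => u0.
have uu : 0 < `|u| ^+ 2 by rewrite exprn_gt0 // normr_gt0.
(* The offset makes the linear part equal to -2(|v| + (n+1)|u|^2), which outweighs v; varying n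
   allows the roots of P to be avoided. *)
pose x (n : nat) := `|v| / `|u| ^+ 2 + n.+1%:R.
have fI : injective (fun n => - x n * u^*).
  move=> m n /(mulIf _); rewrite conjC_eq0 u0 => /(_ isT)/oppr_inj/addrI.
  by move/eqP; rewrite eqr_nat eqSS => /eqP.
have [n /h] := poly_nonroot P0 fI.
have xr : (x n)^* = x n.
  by apply: conj_Creal; rewrite ger0_real // addr_ge0 // divr_ge0 // ltW.
rewrite rmorphM rmorphN /= xr conjCK.
have -> : - x n * u^* * u + - x n * u * u^* + v
          = v - 2%:R * (`|v| + n.+1%:R * `|u| ^+ 2).
  have -> : `|v| + n.+1%:R * `|u| ^+ 2 = x n * `|u| ^+ 2.
    by rewrite mulrDl divfK // gt_eqF.
  by rewrite normCK; ring.
rewrite subr_ge0 => hv.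
have nu : 0 < n.+1%:R * `|u| ^+ 2 by rewrite mulr_gt0 // ltr0n.
have v0 : 0 <= v by apply: le_trans hv; rewrite mulr_ge0 // addr_ge0 // ltW.
have : v < v.
  apply: lt_le_trans hv; rewrite ger0_norm // mulrDr -[ltLHS]addr0.
  apply: ler_ltD; first by rewrite mulr_natl mulr2n lerDl.
  by rewrite mulr_gt0 ?ltr0n.
by rewrite ltxx.
Qed.

Lemma affine_eq0 P u v : P != 0 ->
  (forall z, P.[z] != 0 -> z * u + z^* * u^* + v = 0) -> u = 0 /\ v = 0.
Proof.
move=> P0 h.
have u0 : u = 0 by apply: (affine_ge0_const P0 (v := v)) => z /h ->.
split=> //; have [n /h] := poly_nonroot P0 (@mulrIn _ 1 (oner_neq0 C)).
by rewrite u0 conjC0 !mulr0 !add0r.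
Qed.

(** If g < 0, the expression is at most 0 on the disc of radius sqrt(-g) about w, and this disc
    contains infinitely many points w + e/(n+1), so some non-root of P. *)
Lemma normsq_shift_gt0 P w g : P != 0 ->
  (forall z, P.[z] != 0 -> 0 < `|z - w| ^+ 2 + g) -> 0 <= g.
Proof.
move=> P0 h; have [m /h hm] := poly_nonroot P0 (@mulrIn _ 1 (oner_neq0 C)).
have gr : g \is Num.real.
  rewrite -(addrK (`|m%:R - w| ^+ 2) g) [g + _]addrC rpredB //.
    by rewrite ger0_real // ltW.
  by rewrite ger0_real // exprn_ge0.
rewrite real_leNgt ?real0 //; apply/negP => g0.
pose e := sqrtC (- g).
have e0 : 0 < e by rewrite sqrtC_gt0 oppr_gt0.
have fI : injective (fun n => w + e / n.+1%:R).
  move=> i j /addrI /(mulfI _); rewrite gt_eqF // => /(_ isT)/invr_inj.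
  by move/eqP; rewrite eqr_nat eqSS => /eqP.
have [n /h] := poly_nonroot P0 fI.
rewrite [w + _]addrC addrK ger0_norm ?divr_ge0 ?ltW // exprMn sqrtCK.
move=> /lt_geF /negP; apply; rewrite -lerBrDr sub0r exprVn.
rewrite -[leRHS]mulr1 ler_pM2l ?oppr_gt0 // invf_le1 ?exprn_ege1 ?exprn_gt0 ?ltr0n //.
by rewrite ler1n.
Qed.

(* Comparing the linear parts in [z] forces [w = l]; the two bounds then give
   opposite signs for [g]. *)
Lemma normsq_shift_le P w g l : P != 0 ->
  (forall z, P.[z] != 0 -> 0 < `|z - w| ^+ 2 + g <= `|z - l| ^+ 2) ->
  w = l /\ g = 0.
Proof.
move=> P0 h.
have g0 : 0 <= g by apply: (normsq_shift_gt0 P0 (w := w)) => z /h /andP[].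
have wl : (w - l)^* = 0.
  apply: (affine_ge0_const P0 (v := `|l| ^+ 2 - `|w| ^+ 2 - g)) => z /h /andP[_].
  rewrite -subr_ge0 => /le_trans; apply; rewrite le_eqVlt; apply/orP; left.
  by apply/eqP; rewrite !normCK !rmorphB /= !conjCK; ring.
have {}wl : w = l by apply/eqP; rewrite -subr_eq0 -conjC_eq0 wl.
split=> //; apply: le_anti; rewrite g0 andbT.
have [m /h /andP[_]] := poly_nonroot P0 (@mulrIn _ 1 (oner_neq0 C)).
by rewrite wl gerDl.
Qed.

(* Polarization: p(z) p(z)^* = q(z) q(z)^* is polynomial in Re z and Im z, hence
   extends to independent values of z and z^*. *)
Lemma monic_eq_norm p q : p \is monic -> q \is monic ->
  (forall z, `|p.[z]| = `|q.[z]|) -> p = q.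
Proof.
move=> pm qm pq; pose b (r : {poly C}) := map_poly Num.conj r.
have E1 (x y : nat) : p.[x%:R + 'i * y%:R] * (b p).[x%:R - 'i * y%:R]
                    = q.[x%:R + 'i * y%:R] * (b q).[x%:R - 'i * y%:R].
  have -> : x%:R - 'i * y%:R = (x%:R + 'i * y%:R : C)^*.
    by rewrite rmorphD rmorphM /= conjCi !conjC_nat mulNr.
  by rewrite /b !horner_map /= -!normCK pq.
(* For fixed y both sides are polynomials in x agreeing at all naturals, so x becomes arbitrary;
   [E3] then frees y in the same way. *)
have E2 x (y : nat) : p.[x + 'i * y%:R] * (b p).[x - 'i * y%:R]
                    = q.[x + 'i * y%:R] * (b q).[x - 'i * y%:R].
  pose F (r : {poly C}) := (r \Po ('X + ('i * y%:R)%:P)) * (b r \Po ('X - ('i * y%:R)%:P)).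
  have FE r t : (F r).[t] = r.[t + 'i * y%:R] * (b r).[t - 'i * y%:R].
    by rewrite /F hornerM !horner_comp !hornerD hornerN hornerX !hornerC.
  rewrite -!FE; congr (_.[_]); apply: poly_eq_nat => n; rewrite !FE; exact: E1.
have E3 x y : p.[x + 'i * y] * (b p).[x - 'i * y]
            = q.[x + 'i * y] * (b q).[x - 'i * y].
  pose F (r : {poly C}) := (r \Po (x%:P + 'i%:P * 'X)) * (b r \Po (x%:P - 'i%:P * 'X)).
  have FE r t : (F r).[t] = r.[x + 'i * t] * (b r).[x - 'i * t].
    by rewrite /F hornerM !horner_comp !hornerD hornerN !hornerM hornerX !hornerC.
  rewrite -!FE; congr (_.[_]); apply: poly_eq_nat => n; rewrite !FE; exact: E2.
have E4 u v : p.[u] * (b p).[v] = q.[u] * (b q).[v].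
  (* These values of x and y give x + iy = u and x - iy = v. *)
  have := E3 ((u + v) / 2%:R) (- 'i * ((u - v) / 2%:R)).
  rewrite !mulrA mulrN -expr2 sqrCi opprK mul1r -mulrBl -!mulrDl.
  have -> : u + v + (u - v) = u * 2%:R by ring.
  have -> : u + v - (u - v) = v * 2%:R by ring.
  by rewrite !mulfK ?pnatr_eq0.
have bp0 : b p != 0 by rewrite map_poly_eq0 monic_neq0.
have [n bn] := poly_nonroot bp0 (@mulrIn _ 1 (oner_neq0 C)).
(* Fixing v at a non-root of [b p] makes p a scalar multiple of q; leading coefficients force the
   scalar to be 1. *)
have e : p = ((b q).[n%:R] / (b p).[n%:R]) *: q.
  apply: poly_eq_nat => m; rewrite hornerZ; apply: (mulIf bn).
  by rewrite E4 mulrAC divfK // mulrC.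
have := congr1 lead_coef e.
by rewrite lead_coefZ (monicP pm) (monicP qm) mulr1 => c1; rewrite e -c1 scale1r.
Qed.

End OffRoots.

(** * Singular values of zI - A and the invariants of its Gram matrix *)

Section Pseudospectra.
Variable R : realType.
Local Notation C := R[i].

Lemma horner_char_poly (F : comNzRingType) n (A : 'M[F]_n) z :
  (char_poly A).[z] = \det (z%:M - A).
Proof.
rewrite /char_poly -horner_evalE -det_map_mx; congr (\det _).
apply/matrixP => i j; rewrite !mxE /= /horner_eval hornerD hornerN hornerC hornerMn.
by rewrite hornerX.
Qed.

Definition gram n (M : 'M[C]_n) := adjmx M *m M.

Lemma det_gram n (M : 'M[C]_n) : \det (gram M) = `|\det M| ^+ 2.
Proof. by rewrite det_mulmx det_adjmx normCK mulrC. Qed.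

Lemma eq_svals n (M N : 'M[C]_n) :
  char_poly (gram M) = char_poly (gram N) -> svals M = svals N.
Proof.
move=> e; rewrite /svals; congr xget; apply/funext => s.
by rewrite /is_svals -/(gram M) -/(gram N) e.
Qed.

Lemma det_svals n (M : 'M[C]_n) :
  \det (gram M) = \prod_k ((svals M k) ^+ 2)%:C%C.
Proof.
have [_ [_ cs]] := svalsP M.
have := char_poly_det (gram M); rewrite cs -horner_coef0 horner_prod.
rewrite (eq_bigr (fun k => -1 * ((svals M k) ^+ 2)%:C%C)); last first.
  by move=> k _; rewrite hornerXsubC sub0r mulN1r.
rewrite big_split /= prodr_const card_ord => /mulfI -> //.
by rewrite signr_eq0.
Qed.

Lemma resolvent_normE n (A : 'M[C]_n.+1) z :
  resolvent_norm A z = if (char_poly A).[z] == 0 then +oo%E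
                       else ((svals (z%:M - A) ord_max)^-1)%:E.
Proof.
rewrite /resolvent_norm unitmxE unitfE horner_char_poly; case: eqP => //= d0.
rewrite (specnorm_invmx (svalsP _)) // unitmxE unitfE; exact/eqP.
Qed.

Lemma root_char_poly_colP n (A : 'M[C]_n) l : root (char_poly A) l ->
  exists2 x : 'cV[C]_n, x != 0 & A *m x = l *: x.
Proof.
rewrite /root horner_char_poly -det_tr => /det0P[v v0 e].
exists v^T; first by apply: contraNneq v0 => e0; rewrite -(trmxK v) e0 trmx0.
apply/eqP; rewrite eq_sym -subr_eq0 -mul_scalar_mx -mulmxBl; apply/eqP.
by apply: trmx_inj; rewrite trmx_mul trmxK trmx0.
Qed.

Lemma vnorm_gt0 n (x : 'cV[C]_n) : x != 0 -> 0 < vnorm x.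
Proof.
move=> x0; rewrite lt_neqAle vnorm_ge0 andbT eq_sym; apply: contraNneq x0 => v0.
have := vnorm_sq x; rewrite v0 expr0n /= adjmx_mulE => /esym/eqP.
rewrite psumr_eq0 => [/allP h|i _]; last by rewrite exprn_ge0.
apply/eqP/colP => i; rewrite mxE; apply/eqP.
by have := h i (mem_index_enum i); rewrite /= expf_eq0 /= normr_eq0.
Qed.

(** zI - A stretches an eigenvector for l by exactly |z - l|, which is at least the least
    stretch. *)
Lemma svals_min_le_eigen n (A : 'M[C]_n.+1) z l : root (char_poly A) l ->
  ((svals (z%:M - A) ord_max) ^+ 2)%:C%C <= `|z - l| ^+ 2 :> C.
Proof.
move=> /root_char_poly_colP[x x0 Ax].
have := svals_min_le x (svalsP (z%:M - A)).
rewrite mulmxBl mul_scalar_mx Ax -scalerBl vnormZ ler_pM2r ?vnorm_gt0 // => h.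
have -> : `|z - l| ^+ 2 = ((ComplexField.Normc.normc (z - l)) ^+ 2)%:C%C :> C.
  by rewrite rmorphXn.
rewrite lecR ler_sqr ?nnegrE //; first by case: (svalsP (z%:M - A)).
by apply: le_trans h; case: (svalsP (z%:M - A)).
Qed.

(** A single factor above the common lower bound t would push the product above t^n. *)
Lemma prod_eq_const_min (F : numFieldType) n (a : 'I_n -> F) t : 0 < t ->
  (forall k, t <= a k) -> \prod_k a k = t ^+ n -> forall k, a k = t.
Proof.
move=> t0 ta pe k; apply: le_anti; rewrite ta andbT.
have Q0 : 0 < \prod_(i < n | i != k) t by apply: prodr_gt0.
rewrite -(ler_pM2r Q0).
have -> : t * \prod_(i < n | i != k) t = t ^+ n.
  by rewrite -[X in _ ^+ X]card_ord -prodr_const [RHS](bigD1 k).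
rewrite -pe [leRHS](bigD1 k) //=.
rewrite ler_pM2l ?(lt_le_trans t0) //.
by apply: ler_prod => i _; rewrite ltW //= ta.
Qed.

(** The second elementary symmetric function of the eigenvalues. *)
Definition e2mx (N : 'M[C]_3) : C := ((\tr N) ^+ 2 - \tr (N *m N)) / 2%:R.

Lemma eq_char_poly3 (M N : 'M[C]_3) : char_poly M = char_poly N <->
  [/\ \tr M = \tr N, e2mx M = e2mx N & \det M = \det N].
Proof.
rewrite !char_poly3 -/(e2mx M) -/(e2mx N); split; last by case=> -> -> ->.
move=> e; have c i := congr1 (fun p : {poly C} => p`_i) e.
have := (c 0%N, c 1%N, c 2%N).
rewrite !(coefD, coefN, coefXn, coefCM, coefX, coefC) /=.
rewrite !(mulr0, mulr1, oppr0, subr0, sub0r, addr0, add0r).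
by case=> [[/oppr_inj ? ?] /oppr_inj ?].
Qed.

Lemma adjmx_shift n (A : 'M[C]_n) z : adjmx (z%:M - A) = z^*%:M - adjmx A.
Proof. by rewrite adjmxB adjmx_scalar. Qed.

Lemma mxtrace_gram_shift n (A : 'M[C]_n) z :
  \tr (gram (z%:M - A)) =
  n%:R * (z^* * z) - z^* * \tr A - z * (\tr A)^* + \tr (gram A).
Proof.
by rewrite /gram adjmx_shift mxtrace_shifted_product mxtrace_adjmx.
Qed.

Lemma mxtrace_gram_real n (A : 'M[C]_n) : (\tr (gram A))^* = \tr (gram A).
Proof. by rewrite -mxtrace_adjmx /gram adjmxM adjmxK. Qed.

(* The part of [e2mx (gram (z%:M - A))] that the characteristic polynomial of A
   does not determine is |z|^2 |A|_F^2 plus a real-affine function of z. *)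
Lemma e2mx_gram_shift_diff (A B : 'M[C]_3) :
  \tr A = \tr B -> e2mx A = e2mx B ->
  exists u v : C, forall z,
    e2mx (gram (z%:M - A)) - e2mx (gram (z%:M - B)) =
    (\tr (gram A) - \tr (gram B)) * `|z| ^+ 2 + (z * u + z^* * u^* + v).
Proof.
move=> tAB e2AB.
have sAB : \tr (A *m A) = \tr (B *m B).
  move: e2AB; rewrite /e2mx tAB => /(mulIf _).
  by rewrite invr_eq0 pnatr_eq0 => /(_ isT)/addrI/oppr_inj.
have cub (M : 'M[C]_3) : (\tr (adjmx M *m gram M))^* = \tr (M *m gram M).
  by rewrite -mxtrace_adjmx /gram !adjmxM !adjmxK mxtrace_mulC mulmxA.
have sq (M : 'M[C]_3) : \tr (adjmx M *m adjmx M) = (\tr (M *m M))^*.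
  by rewrite -adjmxM mxtrace_adjmx.
(* Apart from the |z|^2 [\tr (gram M)] term and the last three summands, everything depends on tr M
   and tr M^2 alone and cancels in the difference. *)
have E (M : 'M[C]_3) z : e2mx (gram (z%:M - M)) =
    3%:R * `|z| ^+ 4 + z^* ^+ 2 * (((\tr M) ^+ 2 - \tr (M *m M)) / 2%:R)
    + z ^+ 2 * (((\tr M)^* ^+ 2 - (\tr (M *m M))^*) / 2%:R)
    - 2%:R * `|z| ^+ 2 * (z^* * \tr M + z * (\tr M)^*)
    + `|z| ^+ 2 * (\tr (gram M) + \tr M * (\tr M)^*)
    - z^* * (\tr M * \tr (gram M) - \tr (M *m gram M))
    - z * ((\tr M)^* * \tr (gram M) - \tr (adjmx M *m gram M)) + e2mx (gram M).
  rewrite /e2mx mxtrace_gram_shift /gram adjmx_shift.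
  rewrite mxtrace_shifted_product_sq sq mxtrace_adjmx.
  rewrite -[4%N]/(2 * 2)%N exprM normCK; by field; rewrite ?pnatr_eq0.
exists (\tr (adjmx A *m gram A) - \tr (adjmx B *m gram B)
        - (\tr B)^* * (\tr (gram A) - \tr (gram B))).
exists (e2mx (gram A) - e2mx (gram B)) => z.
rewrite !E tAB sAB !(rmorphB, rmorphM) /= !cub conjCK !mxtrace_gram_real.
by ring.
Qed.

End Pseudospectra.

(** * Equivalence of the two conditions *)

Section Equivalence.
Variable R : realType.
Local Notation C := R[i].
Local Notation smin A z := (svals (z%:M - A) ord_max).

Lemma eq_resolvent_norm_smin n (A B : 'M[C]_n.+1) z :
  (char_poly A).[z] != 0 -> char_poly A = char_poly B ->
  resolvent_norm A z = resolvent_norm B z -> smin A z = smin B z.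
Proof.
move=> Az AB; rewrite !resolvent_normE -AB (negbTE Az).
by move=> e; apply: invr_inj; exact: EFin_inj e.
Qed.

Lemma smin_gt0 n (A : 'M[C]_n.+1) z :
  (char_poly A).[z] != 0 -> 0 < (smin A z ^+ 2)%:C%C :> C.
Proof.
rewrite horner_char_poly => Az.
rewrite -[0]/(0%:C%C) ltcR exprn_gt0 //.
by apply: (svals_unitmx_gt0 _ (svalsP _)); rewrite unitmxE unitfE.
Qed.

(* Both Gram matrices have the eigenvalue t = s_3^2 and the same determinant, so
   subtracting their characteristic equations and dividing by t leaves a linear
   relation. *)
Lemma smin_linear (A B : 'M[C]_3) z :
  (char_poly A).[z] != 0 -> char_poly A = char_poly B ->
  smin A z = smin B z ->
  (\tr (gram A) - \tr (gram B)) * (smin A z ^+ 2)%:C%C =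
  e2mx (gram (z%:M - A)) - e2mx (gram (z%:M - B)).
Proof.
move=> Az AB sAB; have t0 := smin_gt0 Az.
have rA := char_poly_gram_root ord_max (svalsP (z%:M - A)).
have rB := char_poly_gram_root ord_max (svalsP (z%:M - B)).
move: rA rB; rewrite -sAB; move: t0; set t := (_ %:C%C) => t0.
rewrite -/(gram _) -/(gram (z%:M - B)) /root !char_poly3 -!/(e2mx _).
rewrite !(hornerD, hornerN, hornerM, hornerXn, hornerX, hornerC).
rewrite !det_gram -!horner_char_poly -AB !mxtrace_gram_shift.
have [-> _ _] := (eq_char_poly3 A B).1 AB.
move=> /eqP eA /eqP eB; apply: (mulfI (lt0r_neq0 t0)); apply: subr0_eq.
rewrite -[RHS](subrr 0) -[X in _ = X - _]eB -[X in _ = _ - X]eA; ring.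
Qed.

(** The least of the three s_k^2 is |z - w|^2 and their product |chi_A(z)|^2 is its cube, so all
    three coincide. *)
Lemma char_poly_gram_const (A : 'M[C]_3) z w :
  (char_poly A).[z] != 0 -> char_poly A = ('X - w%:P) ^+ 3 ->
  (smin A z ^+ 2)%:C%C = `|z - w| ^+ 2 :> C ->
  char_poly (gram (z%:M - A)) = ('X - (`|z - w| ^+ 2)%:P) ^+ 3.
Proof.
move=> Az Aw tw; have [s0 [sn cs]] := svalsP (z%:M - A).
have t0 := smin_gt0 Az.
have h k : (svals (z%:M - A) k ^+ 2)%:C%C = (smin A z ^+ 2)%:C%C :> C.
  apply: (@prod_eq_const_min _ 3
    (fun k => (svals (z%:M - A) k ^+ 2)%:C%C)) => // [j|].
    by rewrite lecR ler_sqr ?nnegrE // sn // -ltnS ltn_ord.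
  rewrite -det_svals det_gram -horner_char_poly Aw horner_exp hornerXsubC tw.
  by rewrite normrX -!exprM.
by rewrite /gram cs (eq_bigr _ (fun k _ => congr1 (fun a => 'X - a%:P) (h k)))
  prodr_const card_ord tw.
Qed.

Lemma eq_resolvent_norm_frobenius (A B : 'M[C]_3) :
  (forall z, resolvent_norm A z = resolvent_norm B z) ->
  char_poly A = char_poly B -> \tr (gram A) = \tr (gram B).
Proof.
move=> hr AB; apply/eqP; rewrite -subr_eq0; apply/negPn/negP.
set c := (X in X != 0) => c0.
have P0 : char_poly A != 0 by rewrite monic_neq0 ?char_poly_monic.
have [tAB e2AB dAB] := (eq_char_poly3 A B).1 AB.
have [u [v uv]] := e2mx_gram_shift_diff tAB e2AB.
have cr : c^* = c by rewrite rmorphB /= !mxtrace_gram_real.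
(* Completing the square: since c is real, c|z|^2 plus the affine part equals c(|z - w|^2 + g). *)
pose w := - (u / c)^*; pose g := v / c - `|w| ^+ 2.
have wE : w = - (u^* / c) by rewrite /w rmorphM fmorphV /= cr.
have wcE : w^* = - (u / c) by rewrite /w rmorphN /= conjCK.
have tE z : (char_poly A).[z] != 0 ->
    (smin A z ^+ 2)%:C%C = `|z - w| ^+ 2 + g :> C.
  move=> Az; have sz := eq_resolvent_norm_smin Az AB (hr z).
  apply: (mulfI c0); rewrite (smin_linear Az AB sz) uv -/c /g.
  rewrite !normCK rmorphB /= wcE wE.
  by field.
have wl l : root (char_poly A) l -> w = l /\ g = 0.
  move=> rl; apply: (normsq_shift_le P0) => z Az.
  by rewrite -(tE z Az) smin_gt0 //= svals_min_le_eigen.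
have [rs ers] := closed_field_poly_normal (char_poly A).
have rw r : r \in rs -> r = w.
  move=> rin; have [] // := wl r; rewrite ers rootZ ?lead_coef_eq0 //.
  by rewrite root_prod_XsubC.
have Aw : char_poly A = ('X - w%:P) ^+ 3.
  have srs : size rs = 3%N.
    have := size_char_poly A; rewrite ers size_scale ?lead_coef_eq0 //.
    by rewrite size_prod_XsubC => -[].
  rewrite ers (monicP (char_poly_monic A)) scale1r -srs.
  rewrite big_seq (eq_bigr (fun=> 'X - w%:P)); last by move=> r /rw ->.
  by rewrite -big_seq big_const_seq count_predT iter_mulr_1.
have g0 : g = 0.
  by apply: (wl w _).2; rewrite Aw /root horner_exp hornerXsubC subrr expr0n.
(* One point off the spectrum suffices: there both Gram matrices have the triple eigenvalue |z -
   w|^2, hence equal traces, which forces c = 0. *)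
have [n An] := poly_nonroot P0 (@mulrIn _ 1 (oner_neq0 C)).
have Bn : (char_poly B).[n%:R] != 0 by rewrite -AB.
have tA := tE _ An; rewrite g0 addr0 in tA.
have tB := tA; rewrite (eq_resolvent_norm_smin An AB (hr _)) in tB.
have Bw : char_poly B = ('X - w%:P) ^+ 3 by rewrite -AB.
have := char_poly_gram_const An Aw tA.
rewrite -(char_poly_gram_const Bn Bw tB) => /eq_char_poly3[+ _ _].
rewrite !mxtrace_gram_shift tAB => /addrI e.
by move: c0; rewrite /c e subrr eqxx.
Qed.

Lemma eq_resolvent_norm_char_poly_gram (A B : 'M[C]_3) :
  (forall z, resolvent_norm A z = resolvent_norm B z) ->
  char_poly A = char_poly B ->
  forall z, char_poly (gram (z%:M - A)) = char_poly (gram (z%:M - B)).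
Proof.
move=> hr AB; have fAB := eq_resolvent_norm_frobenius hr AB.
have P0 : char_poly A != 0 by rewrite monic_neq0 ?char_poly_monic.
have [tAB e2AB dAB] := (eq_char_poly3 A B).1 AB.
have [u [v uv]] := e2mx_gram_shift_diff tAB e2AB.
(* With c = 0 the difference of the e_2's is real-affine, and vanishing off the spectrum kills its
   coefficients. It therefore vanishes at the eigenvalues too, where both resolvent norms are
   infinite and carry no further information. *)
have [u0 v0] : u = 0 /\ v = 0.
  apply: (affine_eq0 P0) => z Az.
  have := smin_linear Az AB (eq_resolvent_norm_smin Az AB (hr z)).
  by rewrite uv fAB subrr !mul0r add0r.
move=> z; apply/eq_char_poly3; split.
- by rewrite !mxtrace_gram_shift tAB fAB.
- apply/eqP; rewrite -subr_eq0 uv fAB subrr u0 v0 conjC0.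
  by rewrite !mulr0 mul0r !addr0.
- by rewrite !det_gram -!horner_char_poly AB.
Qed.

(** The product of the s_k^2 is |chi_A(z)|^2, so the two characteristic polynomials have equal
    modulus everywhere and [monic_eq_norm] applies. *)
Lemma eq_svals_char_poly n (A B : 'M[C]_n) :
  (forall z, svals (z%:M - A) = svals (z%:M - B)) -> char_poly A = char_poly B.
Proof.
move=> h; apply: monic_eq_norm; rewrite ?char_poly_monic // => z.
apply/eqP; rewrite -(@eqrXn2 _ 2) //; apply/eqP.
by rewrite !horner_char_poly -!det_gram !det_svals h.
Qed.

End Equivalence.


Theorem theorem6 (R : realType) (A B : 'M[R[i]]_3) :
  ((forall z : R[i], resolvent_norm A z = resolvent_norm B z) /\
   char_poly A = char_poly B)
  <->
  (forall (z : R[i]) (k : 'I_3), svals (z%:M - A) k = svals (z%:M - B) k).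
Proof.
split=> [[hr AB] z k|h].
  by rewrite (eq_svals (eq_resolvent_norm_char_poly_gram hr AB z)).
have h' z : svals (z%:M - A) = svals (z%:M - B) by apply/funext => k.
have AB := eq_svals_char_poly h'.
split; last exact: AB.
(* Equal characteristic polynomials make both resolvent norms infinite at the same points. *)
by move=> z; rewrite !resolvent_normE AB h'.
Qed.
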